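(* Let $G$ be a finite simple strongly connected directed graph on $n$ vertices in which every vertex has in-degree at least one, and set $\tau(v)=\lceil (\deg^{in}(v)+1)/2\rceil$ for every vertex $v$ of $G$. Then the smallest size of a dynamic monopoly for $(G,\tau)$ is at most $\lfloor n/2\rfloor$.
   Context: A directed graph is simple if it has no loops and there is at most one edge between any two vertices (in particular there is no directed cycle of length two). It is strongly connected if for any two distinct vertices $u,v$ there is a directed path from $u$ to $v$. $\deg^{in}(v)$ denotes the in-degree of $v$, i.e. the number of vertices $u$ such that there is an edge from $u$ to $v$. Given a directed graph $G$ and a threshold assignment $\tau:V(G)\to\mathbb{N}$, a subset $M\subseteq V(G)$ is a dynamic monopoly (dynamo) for $(G,\tau)$ if $V(G)$ can be partitioned as $D_0\cup D_1\cup\dots\cup D_t$ with $D_0=M$ such that for every $i\ge 1$ and every $v\in D_i$, the number of edges from $D_0\cup\dots\cup D_{i-1}$ to $v$ is at least $\tau(v)$. *)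

(* Defs.v *)
From mathcomp Require Import all_boot.
From mathcomp Require Import boolp.

Set Implicit Arguments.
Unset Strict Implicit.
Unset Printing Implicit Defensive.

(* A directed graph on V is its edge relation: [e u v] is the edge from u to v,
   so parallel edges in the same direction cannot occur. *)
Section Digraphs.
Variables (V : finType) (e : rel V).
Implicit Types (tau : V -> nat) (M : {set V}).

Definition simple_digraph : Prop :=
  irreflexive e /\ forall u v : V, u != v -> ~~ (e u v && e v u).

Definition strongly_connected : Prop :=
  forall u v : V, u != v -> connect e u v.

Definition indeg (v : V) : nat := #|[set u | e u v]|.

(* Blocks of the partition are allowed to be empty; dropping the empty D i with
   0 < i does not affect the condition. *)
Definition dynamo tau M : Prop :=
  exists t : nat, exists D : 'I_t.+1 -> {set V},
    [/\ \bigcup_i D i = [set: V],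
        forall i j, i != j -> [disjoint D i & D j],
        D ord0 = M
      & forall i : 'I_t.+1, 0 < i -> forall v, v \in D i ->
          tau v <= #|[set u in \bigcup_(j < t.+1 | j < i) D j | e u v]| ].

Definition dyn tau : nat :=
  #|[arg min_(M < [set: V] | `[< dynamo tau M >]) #|M|]|.

Lemma dynamo_setT tau : dynamo tau [set: V].
Proof.
exists 0, (fun=> [set: V]); split=> //; first by rewrite big_ord1.
- by move=> i j; rewrite (ord1 i) (ord1 j) eqxx.
- by move=> i; rewrite (ord1 i).
Qed.

Lemma dyn_attained tau : exists2 M, dynamo tau M & #|M| = dyn tau.
Proof.
rewrite /dyn; case: arg_minnP => [|M /asboolP dM _]; last by exists M.
exact/asboolP/dynamo_setT.
Qed.

Lemma dyn_min tau M : dynamo tau M -> dyn tau <= #|M|.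
Proof.
rewrite /dyn; case: arg_minnP => [|N _ minN dM]; last exact/minN/asboolP.
exact/asboolP/dynamo_setT.
Qed.

End Digraphs.

(* ceil ((indeg v + 1) / 2), as uphalf k is k / 2 rounded up *)
Definition strict_majority (V : finType) (e : rel V) (v : V) : nat :=
  uphalf (indeg e v + 1).

(* Main.v *)
(* Call a vertex set N degenerate if each nonempty S in N has a vertex v with
   fewer than deg^in(v)/2 in-neighbours in S; the complement of a degenerate set
   is a strict majority dynamo.  So it suffices to 2-colour V with both colour
   classes degenerate, in the manner of Brooks' theorem: then the smaller class
   is a dynamo.

   If this is impossible, strong connectivity gives a colouring of V minus a
   hole r, and every hole v is tied: it has exactly deg^in(v)/2 in-neighbours of
   each colour.  The hole r can be moved to any in-neighbour x, r taking the
   colour of x.  Let A be the set of ancestors of r through vertices of colour 1,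
   r included.  Every vertex of A can be made the hole without changing the
   colouring elsewhere, and A is strongly connected.  Moving the hole out of A
   and back in, and comparing the ties before and after, shows that a path
   leaving A at a can only return to A at a (this fails if 2-cycles are allowed,
   as in a bidirected odd cycle).  Hence the colours can be exchanged on the
   vertices reached from r outside A; afterwards all in-neighbours of r have
   colour 1, and r is no longer tied. *)
Require Import Defs.
From mathcomp Require Import all_boot.
From mathcomp Require Import boolp zify.

Set Implicit Arguments.
Unset Strict Implicit.
Unset Printing Implicit Defensive.

Section Degenerate.
Variables (V : finType) (e : rel V).
Implicit Types (N S X Y : {set V}) (u v x : V) (c : V -> bool) (b : bool).

Definition indeg_in S v : nat := #|[set u in S | e u v]|.

Definition degenerate N : Prop :=
  forall S, S \subset N -> S != set0 ->
    exists2 v, v \in S & 2 * indeg_in S v < indeg e v.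

Lemma indeg_inS S N v : S \subset N -> indeg_in S v <= indeg_in N v.
Proof.
move=> sSN; apply/subset_leq_card/subsetP => u.
by rewrite !inE => /andP[/(subsetP sSN) -> ->].
Qed.

Lemma indeg_inID S N v :
  indeg_in (N :&: S) v + indeg_in (N :\: S) v = indeg_in N v.
Proof.
rewrite /indeg_in -(cardsID S [set u in N | e u v]); congr (_ + _);
  by apply: eq_card => u; rewrite !inE -?andbA;
     do ![case: (_ \in _) => //=]; rewrite andbC.
Qed.

Lemma indeg_inT v : indeg_in [set: V] v = indeg e v.
Proof. by apply: eq_card => u; rewrite !inE. Qed.

Lemma indeg_inC S v : indeg_in S v + indeg_in (~: S) v = indeg e v.
Proof. by rewrite -indeg_inT -(indeg_inID S setT) setTI setTD. Qed.

Lemma degenerateS S N : S \subset N -> degenerate N -> degenerate S.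
Proof. by move=> sSN dN T sTS; apply: dN; apply: subset_trans sSN. Qed.

Lemma degenerate0 : degenerate set0.
Proof. by move=> S; rewrite subset0 => ->. Qed.

Lemma degenerateU1 N v :
  2 * indeg_in (v |: N) v < indeg e v -> degenerate N -> degenerate (v |: N).
Proof.
move=> ltv dN S sS S0; have [vS|vS] := boolP (v \in S).
  by exists v => //; apply: leq_ltn_trans ltv; rewrite leq_mul2l indeg_inS.
apply: dN => //; apply/subsetP => u uS.
move/subsetP/(_ u uS): sS; rewrite !inE => /predU1P[uv|//].
by rewrite -uv uS in vS.
Qed.

(** * From degenerate complements to dynamos *)

Section Activation.
Variable M : {set V}.

Definition activated k : {set V} :=
  iter k (fun K => K :|: [set v | strict_majority e v <= indeg_in K v]) M.

Lemma activatedS k : activated k \subset activated k.+1.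
Proof. exact: subsetUl. Qed.

Lemma activated_mono i j : i <= j -> activated i \subset activated j.
Proof.
elim: j => [|j IHj]; first by rewrite leqn0 => /eqP->.
rewrite leq_eqVlt => /predU1P[->//|/IHj sij].
exact: subset_trans sij (activatedS j).
Qed.

(** Degeneracy applied to the inactive vertices yields one with more than half of its in-neighbours
    active, so every round adds a vertex until all are active. *)
Lemma activated_card k :
  degenerate (~: M) -> activated k = [set: V] \/ k <= #|activated k|.
Proof.
move=> dM; elim: k => [|k IHk]; first by right.
have [allk|/eqP notall] := eqVneq (activated k) setT.
  by left; apply/eqP; rewrite -subTset -allk activatedS.
case: IHk => [//|lek]; right.
have [||v] := dM (~: activated k).
- by rewrite setCS (activated_mono (leq0n k)).
- by apply/set0Pn; apply: contra_notP notall => nK; apply/setP => v; rewrite !inE;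
    apply: contra_notT nK => vK; exists v; rewrite !inE.
rewrite inE => vK ltv; apply: leq_ltn_trans lek _.
apply: proper_card; rewrite properE activatedS /=.
apply/subsetPn; exists v => //; rewrite !inE (negPf vK) /= /strict_majority.
by have := indeg_inC (activated k) v; lia.
Qed.

Lemma degenerate_dynamo : degenerate (~: M) -> dynamo e (strict_majority e) M.
Proof.
move=> dM; have all_act : activated #|V| = setT.
  case: (activated_card #|V| dM) => // le_act.
  by apply/eqP; rewrite eqEcard subsetT cardsT.
pose D (i : 'I_#|V|.+1) :=
  if i == 0 :> nat then M else activated i :\: activated i.-1.
have D_act (i : 'I_#|V|.+1) v : v \in D i -> v \in activated i.
  by rewrite /D; case: eqP => [->//|_]; rewrite inE => /andP[].
have D_before (i : 'I_#|V|.+1) k v : k < i -> v \in D i -> v \notin activated k.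
  move=> ltki; rewrite /D; case: eqP => [i0|_]; first by rewrite i0 in ltki.
  rewrite inE => /andP[vi _]; apply: contra vi.
  by apply/subsetP; apply: activated_mono; lia.
have act_D k v : k <= #|V| -> v \in activated k ->
    exists2 j : 'I_#|V|.+1, j <= k & v \in D j.
  elim: k => [|k IHk] lek vk; first by exists ord0.
  have [vk'|vk'] := boolP (v \in activated k).
    by have [j lejk vj] := IHk (ltnW lek) vk'; exists j => //; apply: leqW.
  by exists (Ordinal (lek : k.+1 < #|V|.+1)) => //; rewrite /D /= !in_setD vk'.
exists #|V|, D; split.
- apply/setP => v; rewrite inE; apply/bigcupP.
  by have [||j _ vj] := act_D #|V| v; rewrite ?all_act ?inE //; exists j.
- move=> i j nij; rewrite -setI_eq0; apply/eqP/setP => v; rewrite !inE.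
  apply/andP => -[vi vj]; have: i != j :> nat by [].
  rewrite neq_ltn => /orP[lt|lt].
    by have := D_before _ _ _ lt vj; rewrite D_act.
  by have := D_before _ _ _ lt vi; rewrite D_act.
- by rewrite /D.
move=> i i_gt0 v vi.
have: v \in activated i.-1.+1 by rewrite prednK // D_act.
rewrite inE (negPf (D_before _ _ _ _ vi)) ?prednK //= inE => /leq_trans; apply.
apply/subset_leq_card/subsetP => u; rewrite !inE => /andP[ui ->]; rewrite andbT.
have [||j ltj uj] := act_D i.-1 u => //; first by have := ltn_ord i; lia.
by apply/bigcupP; exists j => //; rewrite -(prednK i_gt0) ltnS.
Qed.

End Activation.

(* [c] is a colouring of [X] only; its values outside [X] are junk. *)
Definition good c X : Prop := forall b, degenerate [set v in X | c v == b].

Definition recolor c v b u : bool := if u == v then b else c u.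
Arguments recolor c v b u /.

Lemma goodS c X Y : X \subset Y -> good c Y -> good c X.
Proof.
move=> sXY gY b; apply: degenerateS (gY b); apply/subsetP => v.
by rewrite !inE => /andP[/(subsetP sXY) -> ->].
Qed.

Lemma eq_good c c' X : {in X, c =1 c'} -> good c X -> good c' X.
Proof.
move=> eqc g b; apply: degenerateS (g b); apply/subsetP => v.
by rewrite !inE => /andP[vX]; rewrite vX eqc.
Qed.

(** * Extending partial colourings and moving holes *)

Hypothesis irr : irreflexive e.

Lemma good_extend c X v b :
  2 * indeg_in [set u in X | c u == b] v < indeg e v -> good c X ->
  good (recolor c v b) (v |: X).
Proof.
move=> ltv g b'; have [->|nb] := eqVneq b' b.
  set N := [set u in X | c u == b] in ltv *.
  apply: (@degenerateS _ (v |: N)).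
    by apply/subsetP => u; rewrite !inE /=; case: (u =P v).
  apply: degenerateU1 (g b); apply: leq_ltn_trans ltv.
  rewrite leq_mul2l; apply/subset_leq_card/subsetP => u; rewrite !inE.
  by case: eqP => //= ->; rewrite irr.
apply: degenerateS (g b'); apply/subsetP => u; rewrite !inE /=.
by case: (u =P v) => //= _; rewrite eq_sym (negPf nb) ?andbF.
Qed.

Lemma indeg_in_color c X v :
  indeg_in [set u in X | c u == true] v + indeg_in [set u in X | c u == false] v
  = indeg_in X v.
Proof.
rewrite -(indeg_inID [set u | c u] X); congr (_ + _); apply: eq_card => u;
by rewrite !inE; case: (c u); rewrite ?andbT ?andbF.
Qed.

(** The last hypothesis forces exactly half of the in-neighbours of [u] into each colour;
    uncolouring [x] brings its colour below half, so [u] can take it. *)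
Lemma good_shift c X u x : u \notin X -> x \in X -> e x u -> good c X ->
  (forall b, indeg e u <= 2 * indeg_in [set z in X | c z == b] u) ->
  good (recolor c u (c x)) (u |: (X :\ x)).
Proof.
move=> uX xX xu g tie; apply: good_extend; last exact: goodS (subD1set _ _) g.
have := indeg_in_color c X u; have := indeg_inC X u.
have := tie (c x); have := tie (~~ c x).
set N := [set z in X | c z == c x].
have -> : [set z in X :\ x | c z == c x] = N :\ x by apply/setP => z; rewrite !inE andbA.
have : indeg_in N u = (indeg_in (N :\ x) u).+1.
  rewrite /indeg_in (cardsD1 x) !inE xX xu eqxx /= add1n; congr _.+1.
  by apply: eq_card => z; rewrite !inE !andbA.
rewrite {}/N; case: (c x) => /=; lia.
Qed.


(* The colouring after moving the hole from the end of the path [a :: p] back to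
   [a]: each vertex of [p] takes the old colour of its predecessor. *)
Fixpoint shift c a (p : seq V) : V -> bool :=
  if p is x :: q then recolor (shift c x q) x (c a) else c.

Lemma shift_notin c a p z : z \notin p -> shift c a p z = c z.
Proof.
elim: p a => //= x p IHp a; rewrite inE negb_or.
by case/andP=> /negPf-> zp; exact: IHp.
Qed.

Lemma eq_shift c c' a p :
  {in a :: p, c =1 c'} -> {in p, shift c a p =1 shift c' a p}.
Proof.
elim: p a => //= x p IHp a eqc z; rewrite inE /=.
case: eqP => [_ _|_ /= zp]; first by apply: eqc; rewrite mem_head.
by apply: IHp => // y yp; apply: eqc; rewrite inE yp orbT.
Qed.

Lemma shift_rcons c a q w z : w \notin q ->
  shift c a (rcons q w) z = if z == w then c (last a q) else shift c a q z.
Proof.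
elim: q a => //= x q IHq a; rewrite inE negb_or => /andP[wx wq].
by case: eqP => [->|_]; [rewrite eq_sym (negPf wx) | exact: IHq].
Qed.

(** * Colourings that miss a single vertex *)

Section Hole.

Hypothesis asym : forall u v, e u v -> ~~ e v u.
Hypothesis sc : forall u v, connect e u v.
Hypothesis pos : forall v, 0 < indeg e v.
Hypothesis no_good : forall c, ~ good c [set: V].

Lemma exists_hole : exists c r, good c [set~ r].
Proof.
pose P X := `[< exists c, good c X >]; have P0 : P set0.
  apply/asboolP; exists xpredT => b; apply: degenerateS degenerate0.
  by apply/subsetP => u; rewrite !inE.
case: (arg_maxnP (fun X : {set V} => #|X|) P0) => X /asboolP[c gX] maxX.
have max c' Y : good c' Y -> #|Y| <= #|X|.
  by move=> gY; apply: maxX; apply/asboolP; exists c'.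
have uncolored c' Y u : good c' Y -> #|Y| = #|X| -> u \notin Y ->
    forall b, indeg e u <= 2 * indeg_in [set z in Y | c' z == b] u.
  move=> gY cY uY b; rewrite leqNgt; apply/negP => lt.
  by have := max _ _ (good_extend lt gY); rewrite cardsU1 uY cY; lia.
(* Two uncoloured vertices could be brought next to each other by moving one of
   them back along a path, and then one of them could be coloured. *)
have single c' Y u v p : good c' Y -> #|Y| = #|X| -> u \notin Y -> v \notin Y ->
    path e u p -> last u p = v -> u = v.
  elim/last_ind: p v c' Y => [//|p x IHp] v c' Y gY cY uY vY.
  rewrite rcons_path last_rcons => /andP[up /= xv] Exv; rewrite {x}Exv in xv.
  set x := last u p in xv *.
  have tie := uncolored _ _ _ gY cY vY.
  have [xY|xY] := boolP (x \in Y); last first.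
    (* An uncoloured in-neighbour [x] of [v] leaves too few coloured ones for both colours to reach
       half. *)
    have := tie true; have := tie false; have := indeg_in_color c' Y v.
    have := indeg_inC Y v.
    have : 0 < indeg_in (~: Y) v by apply/card_gt0P; exists x; rewrite !inE xY.
    lia.
  apply/eqP; apply: contraT => nuv.
  have Eux : u = x.
    apply: IHp (good_shift vY xY xv gY tie) _ _ _ _ _ => //.
    - by rewrite cardsU1 !inE (negPf vY) andbF /= -cY (cardsD1 x Y) xY.
    - by rewrite !inE (negPf nuv) (negPf uY) andbF.
    - by rewrite !inE eqxx /= orbF; apply: contraNneq vY => <-.
  by rewrite Eux xY in uY.
have [XT|/eqP XT] := eqVneq X setT; first by case: (no_good (c := c)); rewrite -XT.
have [u uX] : exists u, u \notin X.
  apply: contra_notP XT => nX; apply/setP => v; rewrite !inE.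
  by apply: contra_notT nX => vX; exists v.
have subX v : v != u -> v \in X.
  apply: contraR => vX; have /connectP[p vp Eu] := sc v u.
  exact/eqP/(single _ _ _ _ _ gX (erefl _) vX uX vp).
by exists c, u; apply: goodS gX; apply/subsetP => v; rewrite !inE; apply: subX.
Qed.


Definition cnt c b v : nat := indeg_in [set u | c u == b] v.

Lemma cntE c v : cnt c true v + cnt c false v = indeg e v.
Proof.
rewrite -indeg_inT -(indeg_in_color c).
by congr (_ + _); apply: eq_card => u; rewrite !inE.
Qed.

(** A colour with fewer than half of the in-neighbours of [r] could be given to [r], which would
    colour all of [V]. *)
Lemma hole_cnt c r b : good c [set~ r] -> 2 * cnt c b r = indeg e r.
Proof.
move=> g; have le b' : indeg e r <= 2 * cnt c b' r.
  rewrite leqNgt; apply/negP => lt; case: (no_good (c := recolor c r b')).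
  have -> : [set: V] = r |: [set~ r] by rewrite setUCr.
  apply: good_extend g; apply: leq_ltn_trans lt; rewrite leq_mul2l /=.
  by apply: indeg_inS; apply/subsetP => u; rewrite !inE => /andP[].
by have := cntE c r; have := le true; have := le false; case: b; lia.
Qed.

Lemma hole_cnt_eq c c' r b :
  good c [set~ r] -> good c' [set~ r] -> cnt c b r = cnt c' b r.
Proof. by move=> g g'; have := hole_cnt b g; have := hole_cnt b g'; lia. Qed.

Lemma cnt_lt c c' v w : (forall u, e u v -> c u -> c' u) ->
  e w v -> ~~ c w -> c' w -> cnt c true v < cnt c' true v.
Proof.
move=> sub wv cw c'w; apply: proper_card; rewrite properE; apply/andP; split.
  by apply/subsetP => u; rewrite !inE !eqb_id => /andP[/sub c'u uv]; rewrite c'u.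
by apply/subsetPn; exists w; rewrite !inE !eqb_id ?wv ?(negPf cw) ?c'w.
Qed.

Lemma good_move c r x :
  e x r -> good c [set~ r] -> good (recolor c r (c x)) [set~ x].
Proof.
move=> xr g; have nxr : x != r by apply: contraTneq xr => ->; rewrite irr.
apply: goodS (good_shift _ _ xr g _); rewrite ?inE ?eqxx //.
  by apply/subsetP => u; rewrite !inE => -> /=; rewrite orbN.
move=> b; rewrite -(hole_cnt b g) leq_mul2l /=; apply: subset_leq_card.
apply/subsetP => u; rewrite !inE => /andP[-> ur]; rewrite ur !andbT.
by apply: contraTneq ur => ->; rewrite irr.
Qed.

Lemma good_shift_path c a p :
  path e a p -> uniq (a :: p) -> good c [set~ last a p] ->
  good (shift c a p) [set~ a].
Proof.
elim: p a => //= x p IHp a /andP[ax xp]; rewrite inE negb_or.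
case/andP=> /andP[nax ap] up g.
have := good_move ax (IHp x xp up g).
by rewrite (shift_notin _ _ ap).
Qed.

(** Each move gives [true] to a vertex already storing [true], so the same function [c] serves for
    both holes. *)
Lemma good_move_path c v s :
  path e v s -> all c (v :: s) -> good c [set~ last v s] -> good c [set~ v].
Proof.
elim: s v => //= x s IHs v /andP[vx xs] /and3P[cv cx cs] g.
apply: eq_good (good_move vx (IHs x xs _ g)); last by rewrite /= cx.
by move=> u _ /=; case: eqP => // ->; rewrite cv cx.
Qed.

(** * The colour-1 component of the hole *)

Section Component.

Variables (c : V -> bool) (r : V).
Hypotheses (cr : c r) (gr : good c [set~ r]).

Let ec : rel V := fun u v => [&& e u v, c u & c v].

(** The arbitrary value of [c] at the hole is taken to be [true] so that edges into [r] can belong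
    to [ec]. *)
Definition comp : {set V} := [set a | connect ec a r].
Local Notation A := comp.

Lemma path_ec v s : path ec v s -> c v -> path e v s && all c (v :: s).
Proof.
elim: s v => [|x s IHs] v /=; first by move=> _ ->.
by case/andP=> /and3P[-> -> cx] /IHs /(_ cx) /= /andP[-> ->].
Qed.

Lemma comp_color a : a \in A -> c a.
Proof.
rewrite inE => /connectP[[_ /= <-//|x p]].
by case/andP=> /and3P[].
Qed.

Lemma comp_good a : a \in A -> good c [set~ a].
Proof.
move=> aA; have ca := comp_color aA; rewrite inE in aA.
have /connectP[p /path_ec/(_ ca)/andP[ap cp] Er] := aA.
by apply: good_move_path ap cp _; rewrite -Er.
Qed.

Lemma comp_closed a u : a \in A -> e u a -> c u -> u \in A.
Proof.
move=> aA ua cu; have ca := comp_color aA; rewrite !inE in aA *.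
by apply: connect_trans aA; apply: connect1; rewrite /ec ua cu ca.
Qed.

(** Otherwise the ancestors of [a] under [ec] avoid [h], so degeneracy applies to them with [h] as
    the hole. But they contain all colour-1 in-neighbours of each member, which by the tie are
    exactly half. *)
Lemma comp_connect h a : h \in A -> a \in A -> connect ec h a.
Proof.
move=> hA aA; apply: contraT => nha.
pose S := [set u | connect ec u a].
have sSA u : u \in S -> u \in A.
  by rewrite !inE => ua; rewrite inE in aA; apply: connect_trans aA.
have [||v vS] := comp_good hA (b := true) (S := S).
- apply/subsetP => u uS; rewrite !inE comp_color ?sSA // andbT.
  by apply: contraNneq nha => <-; rewrite inE in uS.
- by apply/set0Pn; exists a; rewrite inE.
have vA := sSA v vS; rewrite ltnNge -(hole_cnt true (comp_good vA)) leq_mul2l /=.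
case/negP; apply: subset_leq_card; apply/subsetP => u.
rewrite !inE eqb_id => /andP[cu uv]; rewrite uv andbT.
rewrite inE in vS; apply: connect_trans vS.
by apply: connect1; rewrite /ec uv cu comp_color.
Qed.

(** Induction on the last vertex of [q]. The second claim drives it: moving the hole back along [q]
    is invisible from [a], so besides the old hole only the new vertex [w] can affect a tie. *)
Lemma external_return a q : a \in A -> path e a q -> uniq (a :: q) ->
    all [predC A] q ->
  (forall z h, z \in q -> h \in A -> e z h -> h = a)
  /\ (forall z, z \in q -> e z a -> shift c a q z = c z).
Proof.
move=> aA; elim/last_ind: q => [//|q w IHq]; rewrite rcons_path.
case/andP=> aq qw; rewrite -rcons_cons rcons_uniq all_rcons.
case/andP=> waq uq /andP[/= wA qA].
have [ret_q keep_q] := IHq aq uq qA.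
have [nwa wq] : w != a /\ w \notin q by apply/andP; rewrite -negb_or -in_cons.
have notA z : z \in rcons q w -> z \notin A.
  by rewrite mem_rcons inE => /predU1P[->//|/(allP qA)].
have aq' : a \notin q by case/andP: uq.
(* [c2 h] is reached from the hole h by moving it to w and back along q to a. *)
pose y := last a q; have yw : e y w by [].
pose c2 h := shift (recolor c h false) a (rcons q w).
have cw h : h \in A -> e w h -> c w = false.
  by move=> hA wh; apply: contraNF wA; apply: comp_closed wh.
have good2 h : h \in A -> e w h -> good (c2 h) [set~ a].
  move=> hA wh; apply: good_shift_path.
  - by rewrite rcons_path aq.
  - by rewrite -rcons_cons rcons_uniq waq.
  by rewrite last_rcons -(cw h) //; apply: good_move wh (comp_good hA).
have c2w h : c2 h w = if y == h then false else c y.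
  by rewrite /c2 shift_rcons // eqxx.
have c2E h z v : h \in A -> v \in A -> z != w -> z != h -> e z v -> c2 h z = c z.
  move=> hA vA nzw nzh zv; have [zq|zq] := boolP (z \in q); last first.
    by rewrite /c2 shift_notin /= ?(negPf nzh) // mem_rcons inE negb_or nzw.
  have va := ret_q _ _ zq vA zv; rewrite {v vA}va in zv.
  rewrite -(keep_q z) // /c2 shift_rcons // (negPf nzw).
  (* The first vertex of [q] takes the colour of [a], which differs if [h] is [a]; the absence of
     2-cycles keeps that vertex from having an edge to [a]. *)
  case: q aq zq qA {IHq uq waq qw ret_q keep_q wq notA aq' y yw c2 good2 c2w nzw}
    => //= x q /andP[ax _]; rewrite inE; case: eqP => [zx|_ /= zq xqA].
    by have := asym ax; rewrite -zx zv.
  apply: eq_shift zq => u uq /=; case: eqP => // uh.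
  by have /allP/(_ u uq) : all [predC A] (x :: q) := xqA; rewrite /= uh hA.
(* With [h] equal to [a], only [w] among the in-neighbours of [a] could change colour, from [false]
   to [c y]; the tie at [a] forbids it. *)
have keep_w : e w a -> c y = false.
  move=> wa; apply/negP => cy.
  have nya : y != a by apply: contraTneq yw => ->; exact: asym.
  have g2 := good2 a aA wa.
  suff: cnt c true a < cnt (c2 a) true a.
    by rewrite (hole_cnt_eq true (comp_good aA) g2) ltnn.
  apply: (cnt_lt (w := w)) => //; last by rewrite c2w (negPf nya).
    move=> u ua cu; rewrite (c2E a u a) //.
      by apply: contraTneq cu => ->; rewrite (cw a).
    by apply: contraTneq ua => ->; rewrite irr.
  by rewrite (cw a).
(* When [c2 h] is compared with c at v, [h] has lost colour 1 and only [w] can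
   have gained it, so the tie at v forces [e w v] and [c y]. *)
have twin h v s : h \in A -> e w h -> v \in A -> path ec v s -> last v s = a ->
    h \notin v :: s -> e h v -> e w v && c y.
  move=> hA wh vA vs sa hs hv.
  have sA z : z \in v :: s -> z \in A.
    move=> zs; rewrite inE; rewrite inE in aA; apply: connect_trans aA.
    rewrite -sa; case/splitPl: zs vs => p1 p2 <-; rewrite cat_path last_cat.
    by case/andP=> _ p2e; apply/connectP; exists p2.
  have [vse vsc] := andP (path_ec vs (comp_color vA)).
  have g2 : good (c2 h) [set~ v].
    apply: good_move_path vse _ _; last by rewrite sa; apply: good2.
    apply/allP => z zs; have zA := sA z zs.
    rewrite /c2 shift_notin /=; last by apply: contraL zA; apply: notA.
    by rewrite comp_color //; case: eqP => // zh; rewrite -zh zs in hs.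
  apply: contraT => nwv.
  suff: cnt (c2 h) true v < cnt c true v.
    by rewrite (hole_cnt_eq true g2 (comp_good vA)) ltnn.
  have nhw : h != w by apply: contraNneq wA => <-.
  apply: (cnt_lt (w := h)) => //; last exact: comp_color.
    move=> u uv; have [->|nuh] := eqVneq u h; first by rewrite comp_color.
    have [Eu|nuw] := eqVneq u w; last by rewrite (c2E h u v).
    by move: nwv; rewrite Eu in uv *; rewrite uv c2w /=; case: eqP => // _ /negPf->.
  by rewrite /c2 shift_notin /= ?eqxx //; apply: contraL hA; apply: notA.
(* Along a simple path in [A] from [h] to [a], [twin] passes the edge from [w] on to the next vertex
   and finally to [a], where [c y] contradicts [keep_w]; so the path is empty. *)
have ret_w h : h \in A -> e w h -> h = a.
  move=> hA wh; have /connectP[s hs sa] := comp_connect hA aA.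
  case/shortenP: hs sa => t ht ut _ /esym sa; move: ht ut sa => {s}.
  elim: t h hA wh => [//|v s IHs] h hA wh /= /andP[/andP[hv _] vs] /andP[hs us] sa.
  have vA : v \in A.
    rewrite inE; rewrite inE in aA; apply: connect_trans aA.
    by apply/connectP; exists s.
  have [wv cy] := andP (twin h v s hA wh vA vs sa hs hv).
  have va := IHs v vA wv vs us sa.
  by rewrite va in wv; rewrite keep_w in cy.
split=> [z h|z]; rewrite mem_rcons inE.
  by case/predU1P=> [->|zq]; [apply: ret_w | apply: ret_q].
case: (eqVneq z w) => [-> _ wa|nzw /= zq za].
  by rewrite shift_rcons // eqxx -/y keep_w // (cw a).
by rewrite shift_rcons // (negPf nzw) keep_q.
Qed.

(** * Return paths and the exchange of colours *)

Let out : rel V := fun u v => e u v && (v \notin A).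

Lemma external_connect_return a w h :
  a \in A -> h \in A -> connect out a w -> w \notin A -> e w h -> h = a.
Proof.
move=> aA hA /connectP[p ap ->] wA wh.
case/shortenP: ap wA wh => q aq uq _ wA wh.
have [] := @external_return a q aA _ uq _.
- by apply: sub_path aq => u v /andP[].
- elim: q a {aA uq wA wh} aq => //= x q IHq a /andP[/andP[_ ->]]; exact: IHq.
move=> + _; apply; last exact: wh; last by [].
by case: q wA {aq uq wh} => [|x q] /=; [rewrite aA | rewrite mem_last].
Qed.

Lemma external_source w : w \notin A -> exists2 a, a \in A & connect out a w.
Proof.
have rA : r \in A by rewrite inE.
have /connectP[p rp ->] := sc r w.
elim/last_ind: p rp => [|p x IHp] /=; first by rewrite rA.
rewrite rcons_path last_rcons => /andP[rp xe] xA.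
have x1 : connect out (last r p) x by apply: connect1; rewrite /out xe.
have [lA|/(IHp rp)[a aA al]] := boolP (last r p \in A); first by exists (last r p).
by exists a => //; apply: connect_trans x1.
Qed.

Lemma hole_absurd : False.
Proof.
have rA : r \in A by rewrite inE.
pose U := [set z | (z \notin A) && connect out r z].
pose c' z := if z \in U then ~~ c z else c z.
have in_U w : w \notin A -> e w r -> w \in U.
  move=> wA wr; have [a aA aw] := external_source wA.
  by rewrite inE wA /= (external_connect_return aA rA aw wA wr).
have U_out z y : z \in U -> e z y -> y != r -> y \in U.
  rewrite ![_ \in U]in_set => /andP[zA rz] zy nyr.
  have yA : y \notin A.
    by apply: contraNN nyr => yA; rewrite (external_connect_return rA yA rz zA zy).
  by rewrite yA /=; apply: connect_trans rz (connect1 _); rewrite /out zy.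
(* A one-coloured set inside [U] has the opposite colour under [c]. Otherwise its part outside [U]
   keeps its colour, and no edge from [U] enters that part. *)
have g' : good c' [set~ r].
  move=> b S sS S0; have [T0|T0] := eqVneq (S :\: U) set0.
    apply: (gr (b := ~~ b)) => //; apply/subsetP => z zS.
    have zU : z \in U.
      by move/eqP: T0; rewrite setD_eq0 => /subsetP; apply.
    move/subsetP/(_ z zS): sS; rewrite inE /c' zU !inE.
    by move=> /andP[-> /eqP<-] /=; rewrite negbK.
  have [|v vT lt] := gr (b := b) _ T0.
    apply/subsetP => z; rewrite in_setD => /andP[zU zS].
    by move/subsetP/(_ z zS): sS; rewrite inE /c' (negPf zU) !inE.
  move: vT; rewrite in_setD => /andP[vU vS]; exists v => //.
  apply: leq_ltn_trans lt; rewrite leq_mul2l /=; apply/subset_leq_card/subsetP => z.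
  rewrite 2!in_set in_setD => /andP[zS zv]; rewrite zS zv !andbT.
  apply: contra vU => zU; apply: U_out zU zv _.
  by move/subsetP/(_ v vS): sS; rewrite !inE => /andP[].
have := hole_cnt false g'; have := pos r.
(* In-neighbours of [r] in [A] have colour [true]. The others lie in [U] and are [false] under [c],
   since [true] would put them in [A]; the exchange makes them [true]. *)
suff -> : cnt c' false r = 0 by lia.
apply: eq_card0 => u; rewrite !inE; apply/negP => /andP[/eqP c'u ur].
have [uA|uA] := boolP (u \in A).
  by move: c'u; rewrite /c' inE uA /= comp_color.
move: c'u; rewrite /c' in_U // => /negbFE cu.
by rewrite (comp_closed rA ur cu) in uA.
Qed.

End Component.

Lemma good_absurd : False.
Proof.
have [c [r gr]] := exists_hole.
apply: (@hole_absurd (recolor c r true) r); first by rewrite /= eqxx.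
by apply: eq_good gr => u; rewrite !inE /= => /negPf->.
Qed.

End Hole.
End Degenerate.

Theorem theorem8 (V : finType) (e : rel V) :
  simple_digraph e ->
  strongly_connected e ->
  (forall v : V, 1 <= indeg e v) ->
  dyn e (strict_majority e) <= #|V| %/ 2.
Proof.
move=> [irr simple] sc pos.
have asym u v : e u v -> ~~ e v u.
  move=> uv; have nuv : u != v by apply: contraTneq uv => ->; rewrite irr.
  by have := simple u v nuv; rewrite uv.
have sc' u v : connect e u v.
  by have [->|/sc//] := eqVneq u v.
have [c gc] : exists c, good e c setT.
  apply: contrapT => ng; apply: (good_absurd irr asym sc' pos) => c gc.
  by apply: ng; exists c.
have dyn_class b : dyn e (strict_majority e) <= #|[set v | c v == b]|.
  apply/dyn_min/degenerate_dynamo; apply: degenerateS (gc (~~ b)).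
  by apply/subsetP => v; rewrite !inE; case: (c v) b => -[].
have: #|[set v | c v == true]| + #|[set v | c v == false]| = #|V|.
  rewrite -(cardsC [set v | c v == true]); congr (_ + _).
  by apply: eq_card => v; rewrite !inE; case: (c v).
by have := dyn_class true; have := dyn_class false; lia.
Qed.
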